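(* For every integer $n\ge 0$, \[ |\mathrm{OSASM}(2n+1)| = 2^{2n}\,X^{\mathrm O}_{2n+2}(1,-1). \]
   Context: An alternating sign matrix (ASM) is a square matrix with entries in $\{-1,0,1\}$ such that in each row and each column the nonzero entries alternate in sign and sum to $1$. A diagonally symmetric ASM (DSASM) is a symmetric ASM. An off-diagonally symmetric ASM (OSASM) of even order is a DSASM all of whose diagonal entries are $0$; an OSASM of odd order is a DSASM with exactly one nonzero diagonal entry. $\mathrm{OSASM}(m)$ denotes the set of OSASMs of order $m$. For an $m\times m$ DSASM $A$, let $R(A)=\sum_{1\le i<j\le m}|A_{i,j}|$ (number of nonzero strictly upper triangular entries) and $T(A)$ the column index of the unique $1$ in the first row of $A$. The OSASM generating function is $X^{\mathrm O}_m(r,t)=\sum_{A\in\mathrm{OSASM}(m)} r^{R(A)}t^{T(A)}$. *)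

(* Defs.v *)
From HB Require Import structures.
From mathcomp Require Import all_boot all_order all_algebra.

Set Implicit Arguments.
Unset Strict Implicit.
Unset Printing Implicit Defensive.

Import Order.TTheory GRing.Theory Num.Theory.
Local Open Scope ring_scope.

Definition alternating (s : seq int) : bool :=
  sorted (fun x y : int => x * y < 0) [seq x <- s | x != 0].

Definition is_asm (m : nat) (A : 'M[int]_m) : bool :=
  [&& [forall i, forall j, A i j \in [:: -1; 0; 1]],
      [forall i, alternating [seq A i j | j <- enum 'I_m]
                 && (\sum_(j < m) A i j == 1)]
    & [forall j, alternating [seq A i j | i <- enum 'I_m]
                 && (\sum_(i < m) A i j == 1)]].

Definition is_dsasm (m : nat) (A : 'M[int]_m) : bool :=
  is_asm A && (A^T == A).

Definition is_osasm (m : nat) (A : 'M[int]_m) : bool :=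
  is_dsasm A && (if odd m then #|[set i | A i i != 0]| == 1%N
                 else [forall i, A i i == 0]).

(* 'M[int]_m is not a finite type, so the set OSASM(m) is taken inside the
   finite type of matrices over the subtype {-1, 0, 1} of int. *)
Definition sign_entry : finType := seq_sub ([:: -1; 0; 1] : seq int).

Definition int_mx (m : nat) (B : 'M[sign_entry]_m) : 'M[int]_m :=
  map_mx val B.

Definition OSASM (m : nat) : {set 'M[sign_entry]_m} :=
  [set B | is_osasm (int_mx B)].

Lemma int_mx_inj (m : nat) : injective (@int_mx m).
Proof.
move=> A B /matrixP eqAB; apply/matrixP => i j.
by apply: val_inj; move: (eqAB i j); rewrite !mxE.
Qed.

Lemma is_osasmP (m : nat) (A : 'M[int]_m) :
  reflect (exists2 B, B \in OSASM m & int_mx B = A) (is_osasm A).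
Proof.
apply: (iffP idP) => [oA | [B + <-]]; last by rewrite inE.
have /andP[/andP[/and3P[/forallP eA _ _] _] _] := oA.
have eAij i j : A i j \in [:: -1; 0; 1] by have /forallP := eA i; apply.
pose B : 'M[sign_entry]_m := \matrix_(i, j) SeqSub (eAij i j).
have BA : int_mx B = A by apply/matrixP => i j; rewrite !mxE.
by exists B; rewrite // inE BA.
Qed.

Definition R_stat (m : nat) (A : 'M[int]_m) : nat :=
  (\sum_(i < m) \sum_(j < m | (i < j)%N) `|A i j|)%N.

(* Columns are numbered from 1, hence the successor. The value 0 is a junk
   value, taken when no entry of the first row is 1. *)
Definition T_stat (m : nat) (A : 'M[int]_m) : nat :=
  if [pick p : 'I_m * 'I_m | (p.1 == 0 :> nat) && (A p.1 p.2 == 1)] is Some p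
  then p.2.+1 else 0.

Definition XO (K : comNzRingType) (m : nat) (r t : K) : K :=
  \sum_(B in OSASM m) r ^+ R_stat (int_mx B) * t ^+ T_stat (int_mx B).

(* Main.v *)
(** A symmetric matrix is read as a state of the six-vertex model on a triangle:
line [i] runs along row [i] to the right of the diagonal, is reflected at the
diagonal, and continues up column [i].  Take weights depending on spectral
parameters x_i at the combinatorial point, with rho a primitive cube root of 1.
For m = 2n+1 let Y(x) be the partition function with exactly one nonzero
diagonal entry, Y'(x) the one obtained by inverting all the x_i (up to a
monomial), and Z(x, -1) the one with zero diagonal and an additional line of
parameter -1.  Then

  (rho - 1) (Y(x) prod (x_i + rho) + Y'(x) prod (1 + rho x_i))
     = - rho^(n+2) Z(x, -1) prod (1 + x_i).

This is an Izergin-Korepin argument.  The Yang-Baxter and reflection equations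
make the partition functions symmetric; both sides are polynomials of degree at
most m in x_1, and at the 2(m-1) points x_1 = rho / x_j and x_1 = rho^2 / x_j
both sides reduce to the identity for m - 2.

At x_i = 1 all vertices have the same weight, so Y and Y' count odd OSASMs,
whereas along the additional line the two weights of a zero entry are opposite,
which yields the sign (-1)^T in the even case. *)
Require Import Defs.
From HB Require Import structures.
From mathcomp Require Import all_boot all_order all_algebra all_field.
From mathcomp Require Import ring zify.
Import Order.TTheory GRing.Theory Num.Theory.
Local Open Scope ring_scope.

Set Implicit Arguments.
Unset Strict Implicit.
Unset Printing Implicit Defensive.

(** * The six-vertex model on a triangle *)

Section Model.
Variables (R : comNzRingType) (wa wb wc1 wc2 wk wD1 wD2 : R -> R).

(* The horizontal line [x] crosses vertical lines [ys], listed from left to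
   right.  Its state [h] at the left end is the row sum taken from the right,
   so it enters on the right in state 0; [v] lists the states (column sums
   taken from the top) above the line, and [phi] weighs those below it.  A
   vertex joining h_in, v_in to h_out, v_out conserves h + v and carries the
   matrix entry h_out - h_in: entry 0 has weight [wa] or [wb], entry 1 weight
   [wc1], entry -1 weight [wc2]. *)
Fixpoint transfer (x : R) (ys : seq R) (h : bool) (phi : seq bool -> R)
    (v : seq bool) : R :=
  match ys, v with
  | y :: ys', v0 :: v' =>
    let r g u := transfer x ys' g (fun t => phi (u :: t)) v' in
    if h == v0 then wa (x * y) * r h h
    else if h then wb (x * y) * r true false + wc1 (x * y) * r false true
    else wb (x * y) * r false true + wc2 (x * y) * r true false
  | [::], [::] => if h then 0 else phi [::]
  | _, _ => 0
  end.

(* The line [x] turns upwards at the diagonal.  The diagonal entry is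
   1 - h - v, so it vanishes when the two states differ (weight [wk]); [d]
   tells whether exactly one nonzero diagonal entry, of weight [wD1] if it is
   1 and [wD2] if it is -1, is present or none. *)
Fixpoint triangle (d : bool) (xs : seq R) (v : seq bool) : R :=
  match xs, v with
  | x :: xs', b :: v' =>
    wk x * transfer x xs' (~~ b) (triangle d xs') v' +
    (if d then (if b then wD2 x else wD1 x)
               * transfer x xs' b (triangle false xs') v'
     else 0)
  | [::], [::] => (~~ d)%:R
  | _, _ => 0
  end.

Definition pfun d xs := triangle d xs (nseq (size xs) false).

Lemma transfer_ext x ys h phi phi' v :
  (forall t, size t = size ys -> phi t = phi' t) ->
  transfer x ys h phi v = transfer x ys h phi' v.
Proof.
elim: ys h phi phi' v => [|y ys IH] h phi phi' [|b v] e //=; first by rewrite e.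
have E u g : transfer x ys g (fun t => phi (u :: t)) v =
             transfer x ys g (fun t => phi' (u :: t)) v.
  by apply: IH => t st; rewrite e //= st.
by rewrite !E.
Qed.

Lemma transferD x ys h phi phi' v :
  transfer x ys h (fun t => phi t + phi' t) v =
  transfer x ys h phi v + transfer x ys h phi' v.
Proof.
elim: ys h phi phi' v => [|y ys IH] h phi phi' [|b v] //=; rewrite ?addr0 //.
  by case: h; rewrite ?addr0.
rewrite !(IH _ (fun t => phi (_ :: t)) (fun t => phi' (_ :: t))).
by case: ifP => _; [|case: ifP => _]; ring.
Qed.

Lemma transferZ x ys h c phi v :
  transfer x ys h (fun t => c * phi t) v = c * transfer x ys h phi v.
Proof.
elim: ys h phi v => [|y ys IH] h phi [|b v] //=; rewrite ?mulr0 //.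
  by case: h; rewrite ?mulr0.
rewrite !(IH _ (fun t => phi (_ :: t))).
by case: ifP => _; [|case: ifP => _]; ring.
Qed.

End Model.

(** * Yang-Baxter and reflection equations *)

Section YB.
Variables (R : comNzRingType) (rho : R) (sw : bool).
Hypothesis rho2 : rho * rho = - rho - 1.

(* With y = x_i x_j these weights have wt_a ^ 2 + wt_b ^ 2 - wt_a wt_b
   = wt_c1 wt_c2, and all four agree at y = 1.  The flag [sw] swaps [wt_a]
   and [wt_b], which amounts to inverting all spectral parameters. *)
Definition wt_a (y : R) := if sw then rho - y else rho * y - 1.
Definition wt_b (y : R) := if sw then rho * y - 1 else rho - y.
Definition wt_c1 (y : R) := rho - 1.
Definition wt_c2 (y : R) := (rho - 1) * y.
Definition wt_k (x : R) := if sw then x + rho else 1 + rho * x.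
Notation transfer := (transfer wt_a wt_b wt_c1 wt_c2).

(* Weights of the crossing that exchanges two parallel lines [x] and [y]. *)
Definition xr_a x y := if sw then x - rho * rho * y else rho * rho * x - y.
Definition xr_b (x y : R) := - rho * (x - y).
Definition xr_c (x : R) := (-1) ^+ sw * (rho * rho - 1) * x.

Definition transfer2 x1 x2 us p s phi v := transfer x1 us p (transfer x2 us s phi) v.

(* Yang-Baxter equation for two horizontal lines. *)
Lemma transfer_train x1 x2 us phi v :
  [/\ xr_a x1 x2 * transfer2 x2 x1 us false false phi v =
        xr_a x1 x2 * transfer2 x1 x2 us false false phi v,
      xr_a x1 x2 * transfer2 x2 x1 us true true phi v =
        xr_a x1 x2 * transfer2 x1 x2 us true true phi v,
      xr_a x1 x2 * transfer2 x2 x1 us false true phi v =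
        xr_c x2 * transfer2 x1 x2 us false true phi v
        + xr_b x1 x2 * transfer2 x1 x2 us true false phi v
    & xr_a x1 x2 * transfer2 x2 x1 us true false phi v =
        xr_c x1 * transfer2 x1 x2 us true false phi v
        + xr_b x1 x2 * transfer2 x1 x2 us false true phi v].
Proof.
elim: us phi v => [|y us IH] phi [|v0 v]; rewrite /transfer2 /=;
  try by split; rewrite ?mulr0 ?addr0.
have e1 c1 c2 h1 h2 u1 u2 x z g :
  transfer x us g (fun t => c1 * transfer z us h1 (fun t' => phi (u1 :: t')) t
                     + c2 * transfer z us h2 (fun t' => phi (u2 :: t')) t) v
  = c1 * transfer2 x z us g h1 (fun t' => phi (u1 :: t')) v
   + c2 * transfer2 x z us g h2 (fun t' => phi (u2 :: t')) v.
  by rewrite transferD !transferZ.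
have e2 c1 h1 u1 x z g :
  transfer x us g (fun t => c1 * transfer z us h1 (fun t' => phi (u1 :: t')) t) v
  = c1 * transfer2 x z us g h1 (fun t' => phi (u1 :: t')) v by rewrite transferZ.
have [a00 a11 a01 a10] := IH (fun t => phi (false :: t)) v.
have [b00 b11 b01 b10] := IH (fun t => phi (true :: t)) v.
(* What remains is the relation at the single column [y], a polynomial identity modulo [rho2]. *)
case: v0 => /=; rewrite !e1 ?e2; split; rewrite ?mulrDr ?(mulrCA (xr_a _ _)).
all: rewrite ?a00 ?a11 ?a01 ?a10 ?b00 ?b11 ?b01 ?b10.
all: rewrite /xr_a /xr_b /xr_c /wt_a /wt_b /wt_c1 /wt_c2; case: sw; ring: rho2.
Qed.

Definition exch x1 x2 n (phi phi' : seq bool -> R) := forall p v, size p = n ->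
  [/\ xr_a x1 x2 * phi' (p ++ false :: false :: v) =
        xr_a x1 x2 * phi (p ++ false :: false :: v),
      xr_a x1 x2 * phi' (p ++ true :: true :: v) =
        xr_a x1 x2 * phi (p ++ true :: true :: v),
      xr_a x1 x2 * phi' (p ++ false :: true :: v) =
        xr_c x1 * phi (p ++ false :: true :: v)
        + xr_b x1 x2 * phi (p ++ true :: false :: v)
    & xr_a x1 x2 * phi' (p ++ true :: false :: v) =
        xr_c x2 * phi (p ++ true :: false :: v)
        + xr_b x1 x2 * phi (p ++ false :: true :: v)].

(* Yang-Baxter equation for two vertical lines. *)
Lemma transfer_exch x1 x2 z ps us h phi phi' : exch x1 x2 (size ps) phi phi' ->
  exch x1 x2 (size ps) (transfer z (ps ++ x1 :: x2 :: us) h phi)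
                       (transfer z (ps ++ x2 :: x1 :: us) h phi').
Proof.
elim: ps h phi phi' => [|y ps IH] h phi phi' E p v sp; case: p sp => [|b p] //= sp.
  have E' g : [/\
      xr_a x1 x2 * transfer z us g (fun t => phi' (false :: false :: t)) v =
        xr_a x1 x2 * transfer z us g (fun t => phi (false :: false :: t)) v,
      xr_a x1 x2 * transfer z us g (fun t => phi' (true :: true :: t)) v =
        xr_a x1 x2 * transfer z us g (fun t => phi (true :: true :: t)) v,
      xr_a x1 x2 * transfer z us g (fun t => phi' (false :: true :: t)) v =
        xr_c x1 * transfer z us g (fun t => phi (false :: true :: t)) v
        + xr_b x1 x2 * transfer z us g (fun t => phi (true :: false :: t)) v
    & xr_a x1 x2 * transfer z us g (fun t => phi' (true :: false :: t)) v =
        xr_c x2 * transfer z us g (fun t => phi (true :: false :: t)) v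
        + xr_b x1 x2 * transfer z us g (fun t => phi (false :: true :: t)) v].
    rewrite -!transferZ -!transferD; split; apply: transfer_ext => t _;
      by case: (E [::] t erefl).
  have [a00 a11 a01 a10] := E' true.
  have [b00 b11 b01 b10] := E' false.
  case: h => /=; split; rewrite ?mulrDr ?(mulrCA (xr_a _ _));
    rewrite ?a00 ?a11 ?a01 ?a10 ?b00 ?b11 ?b01 ?b10;
    rewrite /xr_a /xr_b /xr_c /wt_a /wt_b /wt_c1 /wt_c2; case: sw; ring: rho2.
case: sp => sp.
have E' u : exch x1 x2 (size ps) (fun t => phi (u :: t)) (fun t => phi' (u :: t)).
  by move=> q w sq; apply: (E (u :: q)); rewrite /= sq.
have F u g := IH g _ _ (E' u) p v sp => {IH}.
have [a00 a11 a01 a10] := F true true.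
have [b00 b11 b01 b10] := F false true.
have [c00 c11 c01 c10] := F true false.
have [d00 d11 d01 d10] := F false false.
case: h; case: b => /=; split; rewrite ?mulrDr ?(mulrCA (xr_a _ _));
  rewrite ?a00 ?a11 ?a01 ?a10 ?b00 ?b11 ?b01 ?b10;
  rewrite ?c00 ?c11 ?c01 ?c10 ?d00 ?d11 ?d01 ?d10; ring.
Qed.

Variable (k : R -> R).
Notation triangle := (triangle wt_a wt_b wt_c1 wt_c2 k (fun=> 1) id).

(* When both lines reach the diagonal this is the reflection equation, taken to
   first order in the weight of nonzero diagonal entries. *)
Lemma triangle_exch (d : bool) x1 x2 ps us :
  (d -> k =1 wt_k) ->
  exch x1 x2 (size ps) (triangle d (ps ++ x1 :: x2 :: us))
                       (triangle d (ps ++ x2 :: x1 :: us)).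
Proof.
move=> kE; elim: ps d kE => [|y ps IH] d kE p v sp;
  case: p sp => [|b p] //= sp; last first.
  case: sp => sp.
  have [a00 a11 a01 a10] := transfer_exch y us (~~ b) (IH d kE) v sp.
  have nk : false -> k =1 wt_k by [].
  have [b00 b11 b01 b10] := transfer_exch y us b (IH false nk) v sp.
  case: d {kE} a00 a11 a01 a10 => a00 a11 a01 a10; split;
    rewrite ?mulrDr ?(mulrCA (xr_a _ _)) ?mulr0;
    rewrite ?a00 ?a11 ?a01 ?a10 ?b00 ?b11 ?b01 ?b10; ring.
have e1 x z g w c1 c2 : transfer x us g
    (fun t => c1 * transfer z us (~~ w) (triangle d us) t
              + c2 * transfer z us w (triangle false us) t) v
  = c1 * transfer2 x z us g (~~ w) (triangle d us) v
    + c2 * transfer2 x z us g w (triangle false us) v.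
  by rewrite transferD !transferZ.
have e2 x z g w c1 d' : transfer x us g
    (fun t => c1 * transfer z us w (triangle d' us) t + 0) v
  = c1 * transfer2 x z us g w (triangle d' us) v.
  by rewrite -transferZ; apply: transfer_ext => t _; rewrite addr0.
have [a00 a11 a01 a10] := transfer_train x1 x2 us (triangle d us) v.
have [b00 b11 b01 b10] := transfer_train x1 x2 us (triangle false us) v.
case: d kE e1 e2 a00 a11 a01 a10 => [/(_ isT) kE|_] e1 e2 a00 a11 a01 a10.
  rewrite !(e1 _ _ _ false) !(e1 _ _ _ true) !e2 /= {e1 e2}.
  split; rewrite ?mulrDr ?(mulrCA (xr_a _ _)) ?mulrDr ?(mulrCA (xr_a _ _));
    rewrite ?a00 ?a11 ?a01 ?a10 ?b00 ?b11 ?b01 ?b10 !kE;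
    rewrite /wt_k /wt_a /wt_b /wt_c1 /wt_c2 /xr_a /xr_b /xr_c; case: sw; ring: rho2.
(* With no nonzero diagonal entry every term contains [k x1 * k x2], so any [k] works. *)
rewrite !e2 {e1 e2}.
split; rewrite ?mulrDr ?(mulrCA (xr_a _ _)) ?mulrDr ?(mulrCA (xr_a _ _));
  rewrite ?a00 ?a11 ?a01 ?a10 ?b00 ?b11 ?b01 ?b10;
  rewrite /wt_a /wt_b /wt_c1 /wt_c2 /xr_a /xr_b /xr_c; case: sw; ring: rho2.
Qed.
End YB.

(** * Recursions at zeros of a vertex weight *)

Section Recursion.
Variables (R : comNzRingType) (wa wb wc1 wc2 wk wD1 wD2 : R -> R).
Notation transfer := (transfer wa wb wc1 wc2).
Notation triangle := (triangle wa wb wc1 wc2 wk wD1 wD2).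
Notation pfun := (pfun wa wb wc1 wc2 wk wD1 wD2).

Lemma transfer_false0 x ys phi : transfer x ys false phi (nseq (size ys) false) =
  \prod_(y <- ys) wa (x * y) * phi (nseq (size ys) false).
Proof.
elim: ys phi => [|y ys IH] phi /=; first by rewrite big_nil mul1r.
by rewrite IH big_cons mulrA.
Qed.

(* When [wb (x1 * x2)] vanishes, the 1 of the first row is forced into column 2
   unless a diagonal defect is used up in the first two rows; the hypothesis on
   [d] makes the contributions of the latter cancel. *)
Lemma pfun_head x1 x2 us (d : bool) :
  wb (x1 * x2) = 0 ->
  (d -> wD1 x1 * wa (x1 * x2) * wk x2 + wk x1 * wc1 (x1 * x2) * wD2 x2 = 0) ->
  pfun d (x1 :: x2 :: us) = wk x1 * wk x2 * wc1 (x1 * x2)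
    * (\prod_(u <- us) wa (x1 * u) * \prod_(u <- us) wa (x2 * u)) * pfun d us.
Proof.
move=> b0 cancel; rewrite /pfun /= b0 !transfer_false0.
case: d cancel => [/(_ isT) cancel|_]; last by ring.
(* [A] is a common factor of the two ways to place the nonzero diagonal entry in the first two rows:
   1 in row 1, or -1 in row 2. *)
set A := transfer x2 us true _ _.
transitivity (wk x1 * wk x2 * wc1 (x1 * x2)
    * (\prod_(u <- us) wa (x1 * u) * \prod_(u <- us) wa (x2 * u))
    * triangle true us (nseq (size us) false) +
   (wD1 x1 * wa (x1 * x2) * wk x2 + wk x1 * wc1 (x1 * x2) * wD2 x2)
   * \prod_(u <- us) wa (x1 * u) * A); first by ring.
by rewrite cancel; ring.
Qed.

(** The line enters on the right in state 0 and meets a column in state 0; as [wa] vanishes there,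
    the last entry is 1 and all others are 0. *)
Lemma transfer_rcons_false x us z h phi : wa (x * z) = 0 ->
  transfer x (rcons us z) h phi (nseq (size us).+1 false) =
  if h then \prod_(u <- us) wb (x * u) * wc1 (x * z)
            * phi (rcons (nseq (size us) false) true) else 0.
Proof.
move=> a0; elim: us h phi => [|u us IH] h phi.
  by case: h; rewrite /= ?big_nil ?a0; ring.
have E g w := IH g (fun t => phi (w :: t)).
rewrite [nseq _ _]/= in E; rewrite /= !E big_cons.
by case: h => /=; ring.
Qed.

Lemma transfer_rcons_true x us z h phi v : size v = size us ->
  transfer x (rcons us z) h phi (rcons v true) =
  wb (x * z) * transfer x us h (fun t => phi (rcons t true)) v.
Proof.
elim: us h phi v => [|u us IH] h phi [|b v] //=.
  by move=> _; case: h => /=; ring.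
case=> sv; have E g w := IH g (fun t => phi (w :: t)) v sv.
by rewrite !E; case: h; case: b => /=; ring.
Qed.

(** A last column already in state 1 receives only zeros, since a -1 there would need a 1 further
    right. Its line therefore factors out. *)
Lemma triangle_rcons d us z v : size v = size us ->
  triangle d (rcons us z) (rcons v true) =
  \prod_(u <- us) wb (u * z) * wk z * triangle d us v.
Proof.
elim: us d v => [|u us IH] d [|b v] //=.
  by move=> _; case: d => /=; rewrite big_nil; ring.
case=> sv; rewrite !transfer_rcons_true // big_cons.
have E g d' :
   transfer u us g (fun t => triangle d' (rcons us z) (rcons t true)) v =
   \prod_(u <- us) wb (u * z) * wk z * transfer u us g (triangle d' us) v.
  by rewrite -transferZ; apply: transfer_ext => t st; apply: IH.
by rewrite !E; case: d; ring.
Qed.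

(* When [wa (x1 * z)] vanishes, the 1 of the first row is forced into the last
   column. *)
Lemma pfun_last x1 us z d : wa (x1 * z) = 0 ->
  pfun d (x1 :: rcons us z) = wk x1 * wk z * wc1 (x1 * z)
    * (\prod_(u <- us) wb (x1 * u) * \prod_(u <- us) wb (u * z)) * pfun d us.
Proof.
move=> a0; rewrite /pfun /= size_rcons !transfer_rcons_false //.
rewrite triangle_rcons ?size_nseq //.
by case: d; ring.
Qed.

End Recursion.

(** * Symmetry in the spectral parameters *)

Section Symmetry.
Variables (R : idomainType) (rho : R) (sw : bool).
Hypothesis rho2 : rho * rho = - rho - 1.
Variables (k : R -> R) (d : bool).
Hypothesis kE : d -> k =1 wt_k rho sw.
Notation pfun := (pfun (wt_a rho sw) (wt_b rho sw) (wt_c1 rho) (wt_c2 rho)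
                       k (fun=> 1) id d).

(** At the top all columns are in state 0, where the crossing acts by the scalar [xr_a] on both
    sides and cancels. *)
Lemma pfun_swap ps x y us : xr_a rho sw x y != 0 ->
  pfun (ps ++ x :: y :: us) = pfun (ps ++ y :: x :: us).
Proof.
move=> nz; apply: (mulfI nz).
have [+ _ _ _] := triangle_exch rho2 x y us kE (nseq (size us) false)
  (size_nseq (size ps) false).
move=> E; rewrite /pfun !size_cat /= nseqD /=; exact/esym.
Qed.

Lemma pfun_bubble ps us x vs : {in us, forall u, xr_a rho sw u x != 0} ->
  pfun (ps ++ us ++ x :: vs) = pfun (ps ++ x :: us ++ vs).
Proof.
elim: us ps => [|u us IH] ps //= nz.
rewrite -cat_rcons IH => [|w wus]; last by rewrite nz // inE wus orbT.
by rewrite cat_rcons pfun_swap // nz ?inE ?eqxx.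
Qed.
End Symmetry.

(** * The identity between the odd and the even partition function *)

Section Mismatch.
Variables (R : comNzRingType) (rho : R).

Definition pfunY sw := pfun (wt_a rho sw) (wt_b rho sw) (wt_c1 rho) (wt_c2 rho)
                           (wt_k rho sw) (fun=> 1) id true.
Definition pfunZ := pfun (wt_a rho false) (wt_b rho false) (wt_c1 rho) (wt_c2 rho)
                     (fun=> 1) (fun=> 1) id false.
(* The factor [rho ^+ n.+2] is dictated by the case n = 0 and by the ratio of the
   two recursions in [mismatch_step]. *)
Definition mismatch n xs :=
  (rho - 1) * (pfunY false xs * \prod_(x <- xs) (x + rho)
               + pfunY true xs * \prod_(x <- xs) (1 + rho * x))
  + rho ^+ n.+2 * pfunZ (rcons xs (- 1)) * \prod_(x <- xs) (1 + x).

End Mismatch.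

Section Identity.
Variables (F : fieldType) (rho : F).
Hypothesis rho2 : rho * rho = - rho - 1.
Notation xr_a := (xr_a rho).
Notation pfunY := (pfunY rho).
Notation pfunZ := (pfunZ rho).
Notation mismatch := (mismatch rho).

Lemma pfunY_last sw x y us : {in us, forall u, xr_a sw u y != 0} ->
  pfunY sw (x :: rcons us y) = pfunY sw (x :: y :: us).
Proof.
move=> nz; have := @pfun_bubble _ rho sw rho2 (wt_k rho sw) true
  (fun _ _ => erefl) [:: x] us y [::] nz.
by rewrite cats1 cats0.
Qed.

Lemma pfunZ_last x y us : {in us, forall u, xr_a false u y != 0} ->
  pfunZ (x :: rcons us y) = pfunZ (x :: y :: us).
Proof.
move=> nz; have E : false -> (fun=> 1) =1 wt_k rho false by [].
have := @pfun_bubble _ rho false rho2 (fun=> 1) false E [:: x] us y [::] nz.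
by rewrite cats1 cats0.
Qed.

Lemma prod_mulC (f : F -> F) us z :
  \prod_(u <- us) f (u * z) = \prod_(u <- us) f (z * u).
Proof. by apply: eq_bigr => u _; rewrite mulrC. Qed.

(** At [x * y = rho] the weight [wt_b] vanishes for [sw = false] and [wt_a] for [sw = true]; at
    [rho * rho] the roles are swapped. So [pfun_head] applies to one [pfunY], and [pfun_last] to the
    other once [y] is moved to the end; all three terms acquire the same factor. *)
Lemma mismatch_step n x y us :
  (forall sw, {in rcons us (-1), forall u, xr_a sw u y != 0}) ->
  x * y = rho \/ x * y = rho * rho ->
  exists c, mismatch n.+1 (x :: y :: us) = c * mismatch n us.
Proof.
move=> nz xy.
have nzu sw : {in us, forall u, xr_a sw u y != 0}.
  by move=> u uus; apply: nz; rewrite mem_rcons inE uus orbT.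
have rho3 : rho * rho * rho = 1 by ring: rho2.
case: xy => xy.
  set G := \prod_(u <- us) wt_a rho false (x * u)
           * \prod_(u <- us) wt_a rho false (y * u).
  exists ((rho - 1) * G * ((1 + rho * x) * (1 + rho * y) * ((x + rho) * (y + rho)))).
  have Yf : pfunY false (x :: y :: us) =
     (1 + rho * x) * (1 + rho * y) * (rho - 1) * G * pfunY false us.
    apply: pfun_head => [|_]; rewrite /wt_a /wt_b /wt_c1 /wt_k xy /=.
      by rewrite subrr.
    by ring: rho2 xy.
  have Yt : pfunY true (x :: y :: us) =
     (x + rho) * (y + rho) * (rho - 1) * G * pfunY true us.
    rewrite -pfunY_last // /pfunY pfun_last /wt_a ?xy ?subrr //.
    by rewrite (prod_mulC (wt_b rho true)).
  (* The extra line contributes [wt_a] at [- x] and [- y], that is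
     [(1 + rho * x) * (1 + rho * y)]. *)
  have Z : pfunZ (rcons (x :: y :: us) (-1)) =
     (rho - 1) * G * ((1 + rho * x) * (1 + rho * y)) * pfunZ (rcons us (-1)).
    rewrite /= /pfunZ pfun_head /wt_b ?xy ?subrr // !big_rcons /= -/G.
    by rewrite /G /wt_a /wt_c1; ring.
  rewrite /mismatch Yf Yt Z !big_cons exprS.
  (* The additional [rho] coming from [rho ^+ n.+3] completes the factor shared with both
     [pfunY]. *)
  have e : rho * ((1 + x) * (1 + y)) = (x + rho) * (y + rho).
    by ring: rho2 xy.
  set P := \prod_(x <- us) (1 + x).
  transitivity ((rho - 1) * G * (1 + rho * x) * (1 + rho * y) *
    ((rho - 1) * (x + rho) * (y + rho) *
       (pfunY false us * \prod_(x <- us) (x + rho)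
        + pfunY true us * \prod_(x <- us) (1 + rho * x))
     + rho ^+ n.+2 * pfunZ (rcons us (- 1)) * P
       * (rho * ((1 + x) * (1 + y))))).
    by ring.
  by rewrite e; ring.
set G := \prod_(u <- us) wt_b rho false (x * u)
         * \prod_(u <- us) wt_b rho false (y * u).
exists ((rho - 1) * G * ((1 + rho * x) * (1 + rho * y) * ((x + rho) * (y + rho)))).
have Yt : pfunY true (x :: y :: us) =
   (x + rho) * (y + rho) * (rho - 1) * G * pfunY true us.
  apply: pfun_head => [|_]; rewrite /wt_a /wt_b /wt_c1 /wt_k xy /=.
    by ring: rho3.
  by ring: rho2 xy.
have Yf : pfunY false (x :: y :: us) =
   (1 + rho * x) * (1 + rho * y) * (rho - 1) * G * pfunY false us.
  rewrite -pfunY_last // /pfunY pfun_last /wt_a ?xy; last by ring: rho3.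
  by rewrite (prod_mulC (wt_b rho false)).
(* Here [y] has to pass the extra line too, whence -1 among the parameters in [nz]. *)
have Z : pfunZ (rcons (x :: y :: us) (-1)) =
   (rho - 1) * G * ((x + rho) * (y + rho)) * pfunZ (rcons us (-1)).
  rewrite /= -pfunZ_last // /pfunZ pfun_last /wt_a ?xy; last by ring: rho3.
  by rewrite (prod_mulC (wt_b rho false)) !big_rcons /= /G /wt_b /wt_c1; ring.
rewrite /mismatch Yf Yt Z !big_cons exprS.
have e : rho * ((1 + x) * (1 + y)) = (1 + rho * x) * (1 + rho * y).
  by ring: rho2 xy.
set P := \prod_(x <- us) (1 + x).
transitivity ((rho - 1) * G * (x + rho) * (y + rho) *
  ((rho - 1) * (1 + rho * x) * (1 + rho * y) *
     (pfunY false us * \prod_(x <- us) (x + rho)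
      + pfunY true us * \prod_(x <- us) (1 + rho * x))
   + rho ^+ n.+2 * pfunZ (rcons us (- 1)) * P
     * (rho * ((1 + x) * (1 + y))))).
  by ring.
by rewrite e; ring.
Qed.

(** * Degree bounds in the first spectral parameter *)

Definition poly_fun n (f : F -> F) :=
  exists2 P : {poly F}, (size P <= n)%N & forall x, f x = P.[x].

Lemma poly_fun_eq n f g : f =1 g -> poly_fun n f -> poly_fun n g.
Proof. by move=> fg [P sP fP]; exists P => // x; rewrite -fg. Qed.

Lemma poly_funC n c : poly_fun n.+1 (fun=> c).
Proof.
exists c%:P => [|x]; last by rewrite hornerC.
by rewrite (leq_trans (size_polyC_leq1 c)).
Qed.

Lemma poly_fun_linear n a b : poly_fun n.+2 (fun x => a * x + b).
Proof.
exists (a *: 'X + b%:P) => [|x]; last by rewrite !hornerE.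
rewrite (leq_trans (size_polyD _ _)) // geq_max.
rewrite (leq_trans (size_scale_leq _ _)) ?size_polyX //.
by rewrite (leq_trans (size_polyC_leq1 b)).
Qed.

Lemma poly_funD n f g :
  poly_fun n f -> poly_fun n g -> poly_fun n (fun x => f x + g x).
Proof.
move=> [P sP fP] [Q sQ gQ]; exists (P + Q) => [|x]; last by rewrite fP gQ hornerD.
by rewrite (leq_trans (size_polyD _ _)) // geq_max sP.
Qed.

Lemma poly_funMl m n f g :
  poly_fun m.+1 f -> poly_fun n g -> poly_fun (m + n) (fun x => f x * g x).
Proof.
move=> [P sP fP] [Q sQ gQ]; exists (P * Q) => [|x]; last by rewrite fP gQ hornerM.
rewrite (leq_trans (size_polyMleq _ _)) //.
by move: sP sQ; case: (size P) => [|a]; case: (size Q) => [|b]; lia.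
Qed.

Lemma poly_fun_prod (f : F -> F) ys : (forall y, poly_fun 2 (fun x => f (x * y))) ->
  poly_fun (size ys).+1 (fun x => \prod_(y <- ys) f (x * y)).
Proof.
move=> lf; elim: ys => [|y ys IH] /=.
  by apply: (poly_fun_eq _ (poly_funC 0 1)) => x; rewrite big_nil.
by apply: (poly_fun_eq _ (poly_funMl (lf y) IH)) => x; rewrite big_cons.
Qed.

Lemma poly_fun_wt_a sw y : poly_fun 2 (fun x => wt_a rho sw (x * y)).
Proof.
rewrite /wt_a; case: sw.
  by apply: (poly_fun_eq _ (poly_fun_linear 0 (- y) rho)) => x; ring.
by apply: (poly_fun_eq _ (poly_fun_linear 0 (rho * y) (-1))) => x; ring.
Qed.

Lemma poly_fun_wt_b sw y : poly_fun 2 (fun x => wt_b rho sw (x * y)).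
Proof. by apply: (poly_fun_eq _ (poly_fun_wt_a (~~ sw) y)) => x; case: sw. Qed.

Notation transfer sw :=
  (transfer (wt_a rho sw) (wt_b rho sw) (wt_c1 rho) (wt_c2 rho)).

(** In state 0 the line meets only linear weights; in state 1 it carries exactly one entry 1, whose
    weight [wt_c1] is constant, and the degree drops by one. *)
Lemma poly_fun_transfer sw ys h phi : poly_fun (size ys + ~~ h)
  (fun x => transfer sw x ys h phi (nseq (size ys) false)).
Proof.
have transfer_false zs f : poly_fun (size zs).+1
    (fun x => transfer sw x zs false f (nseq (size zs) false)).
  rewrite -(add0n (size zs).+1).
  apply: (poly_fun_eq _ (poly_funMl (poly_funC 0 (f (nseq (size zs) false)))
                                    (poly_fun_prod zs (poly_fun_wt_a sw)))) => x.
  by rewrite transfer_false0 mulrC.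
case: h; last by rewrite addn1; apply: transfer_false.
rewrite addn0; elim: ys phi => [|y ys IH] phi.
  by exists 0 => [|x]; rewrite ?size_poly0 ?horner0.
apply: poly_funD; first exact: poly_funMl (poly_fun_wt_b sw y) (IH _).
exact: (poly_funMl (poly_funC 0 (rho - 1)) (transfer_false _ _)).
Qed.

(** The linear [wt_k] goes with a line in state 1, of lower degree, and the constant weight of a
    diagonal 1 with a line in state 0, so the bounds agree. *)
Lemma poly_fun_pfunY sw ys : poly_fun (size ys).+1 (fun x => pfunY sw (x :: ys)).
Proof.
apply: poly_funD.
  have lk : poly_fun 2 (wt_k rho sw).
    rewrite /wt_k; case: sw.
      by apply: (poly_fun_eq _ (poly_fun_linear 0 1 rho)) => x; ring.
    by apply: (poly_fun_eq _ (poly_fun_linear 0 rho 1)) => x; ring.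
  by have := poly_funMl lk (poly_fun_transfer sw ys true _); rewrite addn0; apply.
have := poly_funMl (poly_funC 0 1) (poly_fun_transfer sw ys false _).
by rewrite addn1; apply.
Qed.

Lemma poly_fun_pfunZ ys : poly_fun (size ys) (fun x => pfunZ (x :: ys)).
Proof.
have := poly_funMl (poly_funC 0 1) (poly_fun_transfer false ys true
  (triangle (wt_a rho false) (wt_b rho false) (wt_c1 rho) (wt_c2 rho)
            (fun=> 1) (fun=> 1) id false ys)).
by rewrite addn0; apply: poly_fun_eq => x; rewrite /pfunZ /pfun /= addr0.
Qed.

Lemma poly_fun_mismatch n ys : poly_fun (size ys).+2 (fun x => mismatch n (x :: ys)).
Proof.
have C c m f : poly_fun m f -> poly_fun m (fun x => c * f x).
  exact: (poly_funMl (poly_funC 0 c)).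
have P (a b : F) m f : poly_fun m f ->
   poly_fun m.+1 (fun x => f x * \prod_(y <- x :: ys) (a * y + b)).
  move=> pfm.
  apply: (poly_fun_eq _ (poly_funMl (poly_fun_linear 0 a b)
                                    (C (\prod_(y <- ys) (a * y + b)) _ _ pfm))).
  by move=> x; rewrite big_cons; ring.
apply: poly_funD.
  apply: C; apply: poly_funD.
    apply: poly_fun_eq (P 1 rho _ _ (poly_fun_pfunY false ys)) => x.
    by congr (_ * _); apply: eq_bigr => z _; ring.
  apply: poly_fun_eq (P rho 1 _ _ (poly_fun_pfunY true ys)) => x.
  by congr (_ * _); apply: eq_bigr => z _; ring.
have := P 1 1 _ _ (C (rho ^+ n.+2) _ _ (poly_fun_pfunZ (rcons ys (-1)))).
rewrite size_rcons; apply: poly_fun_eq => x.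
by congr (_ * _); apply: eq_bigr => z _; ring.
Qed.

(* Keeps the crossing weight [xr_a] invertible and the interpolation points
   distinct. *)
Definition generic_pair x y := [&& x != y, x != rho * y & y != rho * x].

Lemma generic_pair_sym : symmetric generic_pair.
Proof. by move=> x y; rewrite /generic_pair eq_sym; congr andb; rewrite andbC. Qed.

Lemma generic_xr_a sw x y : generic_pair x y -> xr_a sw x y != 0.
Proof.
case/and3P=> _ nx ny; have rho3 : rho * rho * rho = 1 by ring: rho2.
apply/eqP; rewrite /xr_a; case: sw => e.
  case/eqP: ny; transitivity (rho * (rho * rho * y)); first by ring: rho3.
  by congr (_ * _); apply/esym/eqP; rewrite -subr_eq0 e.
case/eqP: nx; transitivity (rho * (rho * rho * x)); first by ring: rho3.
by congr (_ * _); apply/eqP; rewrite -subr_eq0 e.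
Qed.

Lemma generic_in ys : pairwise generic_pair ys ->
  {in ys &, forall y z, y != z -> generic_pair y z}.
Proof.
elim: ys => //= u ys IH /andP[/allP gu /IH g] y z.
rewrite !inE => /predU1P[->|yys] /predU1P[->|zys]; rewrite ?eqxx // => yz.
- exact: gu.
- by rewrite generic_pair_sym gu.
- exact: g.
Qed.

(** The first parameter is the variable of the interpolation and takes the special values [c / y],
    so genericity is asked of the others only. *)
Lemma mismatch0 n xs : rho != 1 -> size xs = n.*2.+1 ->
  pairwise generic_pair (rcons (behead xs) (-1)) ->
  all (fun x => x != 0) (behead xs) ->
  mismatch n xs = 0.
Proof.
move=> rho1; have rho3 : rho * rho * rho = 1 by ring: rho2.
have rho0 : rho != 0.
  by apply: contra_eq_neq rho3 => ->; rewrite !mul0r eq_sym oner_neq0.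
elim: n xs => [|n IH] [|x ys] //=.
  case: ys => // _ _ _.
  rewrite /mismatch /pfunY /pfunZ /pfun /= !big_seq1 /wt_c1 /=.
  by ring: rho2.
case=> sys gen nz.
have [P sP eP] := poly_fun_mismatch n.+1 ys.
suff P0 : P = 0 by rewrite eP P0 horner0.
set roots1 := [seq rho / y | y <- ys].
set roots2 := [seq rho * rho / y | y <- ys].
(* Symmetry brings [y] into second place, where [mismatch_step] and the induction hypothesis
   apply. *)
have rootP c y : y \in ys -> c = rho \/ c = rho * rho -> root P (c / y).
  move=> yys cE; apply/rootP; rewrite -eP.
  have y0 : y != 0 := allP nz y yys.
  case/splitPr: yys sys gen nz {sP eP} => r1 r2 sys gen nz.
  have gen' : pairwise generic_pair (y :: r1 ++ rcons r2 (-1)).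
    move: gen; rewrite rcons_cat /= !pairwise_cat /= allrel_consr.
    move=> /and4P[/andP[g1 ->] -> g2 ->].
    by rewrite all_cat g2 andbT /= andbT; apply: sub_all g1 => u; rewrite generic_pair_sym.
  have nzr sw u : u \in r1 ++ rcons r2 (-1) -> xr_a sw u y != 0.
    move=> ur; apply: generic_xr_a; rewrite generic_pair_sym.
    by move: gen' => /= /andP[/allP + _]; apply.
  have perm : mismatch n.+1 (c / y :: r1 ++ y :: r2)
            = mismatch n.+1 (c / y :: y :: r1 ++ r2).
    rewrite /mismatch.
    have YE sw : pfunY sw (c / y :: r1 ++ y :: r2)
               = pfunY sw (c / y :: y :: r1 ++ r2).
      apply: (@pfun_bubble _ rho sw rho2 (wt_k rho sw) true
                (fun _ _ => erefl) [:: c / y]).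
      by move=> u ur; apply: nzr; rewrite mem_cat ur.
    have ZE : pfunZ (c / y :: r1 ++ y :: rcons r2 (-1))
            = pfunZ (c / y :: y :: r1 ++ rcons r2 (-1)).
      have E : false -> (fun=> 1) =1 wt_k rho false by [].
      apply: (@pfun_bubble _ rho false rho2 (fun=> 1) false E [:: c / y]).
      by move=> u ur; apply: nzr; rewrite mem_cat ur.
    rewrite /= !rcons_cat /= ZE !YE.
    have BE (f : F -> F) : \prod_(z <- c / y :: r1 ++ y :: r2) f z
                         = \prod_(z <- c / y :: y :: r1 ++ r2) f z.
      by apply: perm_big; rewrite perm_cons -cat1s perm_catCA.
    by rewrite !BE.
  rewrite perm; have [||g ->] := @mismatch_step n (c / y) y (r1 ++ r2).
  - by move=> sw u; rewrite rcons_cat; apply: nzr.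
  - by rewrite divfK.
  rewrite IH ?mulr0 //.
  - by move: sys; rewrite !size_cat /=; lia.
  - move: gen' => /= /andP[_]; apply: subseq_pairwise; rewrite -rcons_cat.
    by case: (r1 ++ r2) => [|a l]; [exact: subseq_refl | exact: subseq_cons].
  - move: nz; rewrite !all_cat /= => /and3P[n1 _ n2].
    have : all (fun x => x != 0) (r1 ++ r2) by rewrite all_cat n1.
    by case: (r1 ++ r2) => //= a l /andP[].
(* As [size ys] is 2n + 2, there are 4n + 4 roots against degree at most 2n + 3. *)
apply: (@roots_geq_poly_eq0 _ _ (roots1 ++ roots2)); last first.
- by rewrite size_cat !size_map sys (leq_trans sP) // sys; lia.
- have genys : pairwise generic_pair ys.
    by move: gen; rewrite pairwise_rcons => /andP[].
  have uys : uniq ys.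
    by rewrite uniq_pairwise; apply: sub_pairwise genys => a b /and3P[].
  have inj c : c != 0 -> {in ys &, injective (fun y => c / y)}.
    by move=> c0 y z _ _ /(mulfI c0) /invr_inj.
  rewrite cat_uniq !map_inj_in_uniq ?uys ?andbT /=;
    try by apply: inj; rewrite ?mulf_neq0.
  apply/hasPn => _ /mapP[y yys ->]; apply/mapP => -[z zys e].
  have y0 : y != 0 := allP nz y yys.
  have z0 : z != 0 := allP nz z zys.
  (* A value common to both families of roots, [rho * rho / y = rho / z], forces this relation,
     which genericity excludes. *)
  have zy : y = rho * z.
    apply: (mulfI rho0); apply: (mulIf (invr_neq0 y0)).
    rewrite -[LHS]mulrA (divff y0).
    transitivity (rho * rho / y * z); last by ring.
    by rewrite e divfK // mulr1.
  have [yz|yz] := eqVneq y z.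
    by case/eqP: rho1; apply: (mulIf z0); rewrite -zy mul1r.
  have : generic_pair y z by apply: (generic_in genys).
  by rewrite /generic_pair zy eqxx andbF.
- rewrite all_cat; apply/andP; split; apply/allP => _ /mapP[y yys ->].
    by apply: rootP => //; left.
  by apply: rootP => //; right.
Qed.
End Identity.

(** * Change of the base ring and specialization of parameters *)

Section Morph.
Variables (R S : comNzRingType) (f : {rmorphism R -> S}).
Variables (wa wb wc1 wc2 wk wD1 wD2 : R -> R).
Variables (wa' wb' wc1' wc2' wk' wD1' wD2' : S -> S).
Hypotheses (fa : forall y, f (wa y) = wa' (f y)) (fb : forall y, f (wb y) = wb' (f y))
  (fc1 : forall y, f (wc1 y) = wc1' (f y)) (fc2 : forall y, f (wc2 y) = wc2' (f y))
  (fk : forall y, f (wk y) = wk' (f y)) (fD1 : forall y, f (wD1 y) = wD1' (f y))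
  (fD2 : forall y, f (wD2 y) = wD2' (f y)).

Lemma rmorph_transfer x ys h phi v :
  f (transfer wa wb wc1 wc2 x ys h phi v) =
  transfer wa' wb' wc1' wc2' (f x) (map f ys) h (fun t => f (phi t)) v.
Proof.
elim: ys h phi v => [|y ys IH] h phi [|b v] //=; rewrite ?rmorph0 //.
  by case: h; rewrite ?rmorph0.
have E g u := IH g (fun t => phi (u :: t)) v.
by case: ifP => _; [|case: ifP => _];
  rewrite ?rmorphD !rmorphM !E /= ?fa ?fb ?fc1 ?fc2 rmorphM.
Qed.

Lemma rmorph_triangle d xs v : f (triangle wa wb wc1 wc2 wk wD1 wD2 d xs v) =
  triangle wa' wb' wc1' wc2' wk' wD1' wD2' d (map f xs) v.
Proof.
elim: xs d v => [|x xs IH] d [|b v] //=; rewrite ?rmorph0 ?rmorph_nat //.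
have E h d' : f (transfer wa wb wc1 wc2 x xs h
                   (triangle wa wb wc1 wc2 wk wD1 wD2 d' xs) v) =
   transfer wa' wb' wc1' wc2' (f x) (map f xs) h
     (triangle wa' wb' wc1' wc2' wk' wD1' wD2' d' (map f xs)) v.
  by rewrite rmorph_transfer; apply: transfer_ext => t _; apply: IH.
rewrite rmorphD rmorphM E fk; case: d => /=; last by rewrite rmorph0.
by rewrite rmorphM E; case: b; rewrite ?fD1 ?fD2.
Qed.

Lemma rmorph_pfun d xs : f (pfun wa wb wc1 wc2 wk wD1 wD2 d xs) =
  pfun wa' wb' wc1' wc2' wk' wD1' wD2' d (map f xs).
Proof. by rewrite /pfun rmorph_triangle size_map. Qed.
End Morph.

(* [mismatch] with the extra line in first position, where its matrix row is the
   first one. *)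
Definition mismatch' (R : comNzRingType) (rho : R) n xs :=
  (rho - 1) * (pfunY rho false xs * \prod_(x <- xs) (x + rho)
               + pfunY rho true xs * \prod_(x <- xs) (1 + rho * x))
  + rho ^+ n.+2 * pfunZ rho (- 1 :: xs) * \prod_(x <- xs) (1 + x).

Lemma rmorph_mismatch' (R S : comNzRingType) (f : {rmorphism R -> S}) rho n xs :
  f (mismatch' rho n xs) = mismatch' (f rho) n (map f xs).
Proof.
rewrite /mismatch'.
move: (rho ^+ n.+2) (f rho ^+ n.+2) (rmorphXn f n.+2 rho) => c c' fc.
rewrite rmorphD !rmorphM rmorphB rmorph1 fc rmorphD !rmorphM.
have fpa sw y : f (wt_a rho sw y) = wt_a (f rho) sw (f y).
  by case: sw; rewrite /wt_a rmorphB ?rmorphM ?rmorph1.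
have fpb sw y : f (wt_b rho sw y) = wt_b (f rho) sw (f y).
  by case: sw; rewrite /wt_b rmorphB ?rmorphM ?rmorph1.
have fpc1 y : f (wt_c1 rho y) = wt_c1 (f rho) (f y).
  by rewrite /wt_c1 rmorphB rmorph1.
have fpc2 y : f (wt_c2 rho y) = wt_c2 (f rho) (f y).
  by rewrite /wt_c2 rmorphM rmorphB rmorph1.
have fkY sw y : f (wt_k rho sw y) = wt_k (f rho) sw (f y).
  by case: sw; rewrite /wt_k rmorphD ?rmorphM ?rmorph1.
have f1 (y : R) : f 1 = 1 by rewrite rmorph1.
have fY sw : f (pfunY rho sw xs) = pfunY (f rho) sw (map f xs).
  exact: (rmorph_pfun (fpa sw) (fpb sw) fpc1 fpc2 (fkY sw) f1 (fun=> erefl)).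
have fZ : f (pfunZ rho (-1 :: xs)) = pfunZ (f rho) (-1 :: map f xs).
  have -> : -1 :: map f xs = map f (-1 :: xs) by rewrite /= rmorphN1.
  exact: (rmorph_pfun (fpa false) (fpb false) fpc1 fpc2 f1 f1 (fun=> erefl)).
rewrite !fY fZ !rmorph_prod !big_map.
by congr (_ * (_ * _ + _ * _) + _ * _); apply: eq_bigr => x _;
  rewrite rmorphD ?rmorphM ?rmorph1.
Qed.

Lemma mismatch'0 (F : fieldType) (rho : F) n xs : rho * rho = - rho - 1 ->
  rho != 1 -> size xs = n.*2.+1 -> pairwise (generic_pair rho) (rcons xs (-1)) ->
  all (fun x => x != 0) xs -> mismatch' rho n xs = 0.
Proof.
move=> rho2 rho1 sxs gen nz; rewrite -(@mismatch0 _ rho rho2 n xs) //.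
- rewrite /mismatch' /mismatch -cats1; congr (_ + _ * _ * _); apply/esym.
  have E : false -> (fun=> 1) =1 wt_k rho false by [].
  rewrite -[X in _ = pfunZ rho (_ :: X)]cats0.
  apply: (@pfun_bubble _ rho false rho2 (fun=> 1) false E [::]) => u uxs.
  move: gen; rewrite pairwise_rcons => /andP[/allP g _].
  by apply: generic_xr_a => //; apply: g.
- apply: subseq_pairwise gen.
  by case: (xs) => [|x l]; [exact: subseq_refl | exact: subseq_cons].
- by case: (xs) nz => //= x l /andP[].
Qed.

(* At x_i = 1 the parameters are not generic, so perturb them to 1 + i X in the
   field of fractions of F[X], then set X = 0. *)
Lemma mismatch'1 (F : numFieldType) (rho : F) n : rho * rho = - rho - 1 ->
  mismatch' rho n (nseq n.*2.+1 1) = 0.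
Proof.
move=> rho2.
have rho1 : rho != 1.
  apply: contra_eq_neq rho2 => ->; rewrite mulr1 -subr_eq0.
  by rewrite (_ : _ - _ = 3%:R) ?pnatr_eq0 //; ring.
have rhoN1 : rho != -1.
  apply: contra_eq_neq rho2 => ->; rewrite -subr_eq0.
  by rewrite (_ : _ - _ = 1) ?oner_neq0 //; ring.
pose xs : seq {poly F} := [seq 1 + (j%:R)%:P * 'X | j <- iota 0 n.*2.+1].
have xs0 : map (horner_eval 0) xs = nseq n.*2.+1 1.
  rewrite /xs -map_comp; elim: n.*2.+1 0%N => //= m IH j.
  by rewrite IH /horner_eval !hornerE.
suff : mismatch' rho%:P n xs = 0.
  move/(congr1 (horner_eval 0)); rewrite rmorph_mismatch' xs0 rmorph0 /=.
  by rewrite /horner_eval hornerC.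
pose f : {rmorphism {poly F} -> {fraction {poly F}}} := @FracField.tofrac {poly F}.
have f_inj p q : (f p == f q) = (p == q) by apply: tofrac_eq.
apply/eqP; rewrite -f_inj; apply/eqP; rewrite rmorph_mismatch' rmorph0.
have fne p q : p.[0] != q.[0] -> f p != f q.
  by rewrite f_inj; apply: contra_neq => ->.
have fN1 : f (-1) = -1 by rewrite rmorphN1.
have fx j : (1 + j%:R%:P * 'X : {poly F}).[0] = 1 by rewrite !hornerE.
(* The two conditions involving [rho] can be checked at X = 0, where all parameters are 1 or -1 and
   [rho] is neither. *)
have genf p q : p != q -> p.[0] != rho * q.[0] -> q.[0] != rho * p.[0] ->
    generic_pair (f rho%:P) (f p) (f q).
  move=> pq h1 h2; apply/and3P; split; first by rewrite f_inj.
    by rewrite -[_ * _](rmorphM f) fne // hornerM hornerC.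
  by rewrite -[_ * _](rmorphM f) fne // hornerM hornerC.
apply: mismatch'0; rewrite ?size_map ?size_iota //.
- rewrite -rmorphM -polyCM rho2 polyCD !polyCN.
  by rewrite !rmorphD !rmorphN polyC1 rmorph1.
- by rewrite -[1](rmorph1 f) fne // hornerC hornerE.
- rewrite -fN1 -map_rcons pairwise_map pairwise_rcons pairwise_map all_map.
  apply/andP; split.
    apply/allP => j _; apply: genf; rewrite ?fx ?hornerN ?hornerC ?mulr1 ?mulrN1.
    - apply: contraTneq isT => /(congr1 (fun p : {poly F} => p.[0])) /eqP.
      by rewrite fx hornerN hornerC -addr_eq0 (_ : 1 + 1 = 2%:R) ?pnatr_eq0.
    - by rewrite eq_sym eqr_oppLR.
    - by rewrite eq_sym.
  have : pairwise [rel j k | j != k] (iota 0 n.*2.+1).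
    by rewrite -uniq_pairwise iota_uniq.
  apply: sub_pairwise => j k /= jk.
  apply: genf; rewrite ?fx ?mulr1 1?eq_sym //.
  (* These parameters coincide at X = 0, so they are separated at X = 1. *)
  rewrite eq_sym; apply: contraNneq jk => /(congr1 (fun p : {poly F} => p.[1])).
  by rewrite !hornerE => /addrI/eqP; rewrite eqr_nat.
- rewrite all_map; apply/allP => _ /mapP[j _ ->] /=.
  by rewrite -(rmorph0 f) fne // fx horner0 oner_neq0.
Qed.

(** * Symmetric matrices as states of the model *)

Definition is01 (s : int) := (s == 0) || (s == 1).

(* [s] is the sum of the entries preceding [l]. *)
Fixpoint alt_from (s : int) (l : seq int) : bool :=
  is01 s && if l is x :: l' then alt_from (s + x) l' else s == 1.

Lemma alt_from01 s l : alt_from s l -> is01 s.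
Proof. by case: l => [|x l] /= /andP[]. Qed.

(* A nonzero entry has to differ in sign from its predecessor; a start in state 0
   or 1 acts like a preceding -1 or 1. *)
Lemma alt_from_path (l : seq int) : all (mem [:: -1; 0; 1]) l ->
  let alt := fun x y : int => x * y < 0 in
  (alt_from 0 l = path alt (-1) [seq x <- l | x != 0] && (\sum_(x <- l) x == 1)) /\
  (alt_from 1 l = path alt 1 [seq x <- l | x != 0] && (\sum_(x <- l) x == 0)).
Proof.
move=> + alt; elim: l => [|x l IH] /=; first by rewrite big_nil.
move=> /andP[x01 /IH[IH0 IH1]].
have N s : ~~ is01 s -> alt_from s l = false.
  by move=> ns; apply: contraNF ns; apply: alt_from01.
rewrite big_cons; move: x01; rewrite !inE => /or3P[]/eqP-> /=.
- rewrite N // addrN IH0 /alt /=; split => //; congr andb; apply/eqP/eqP; lia.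
- by rewrite !addr0 !add0r.
- rewrite (N (1 + 1)) // add0r IH1 /alt /=; split => //.
  by congr andb; apply/eqP/eqP; lia.
Qed.

(** Alternation leaves the sign of the first nonzero entry open; a start with -1 would make the sum
    at most 0, so sum 1 forces a start with 1. *)
Lemma alternating_alt_from (l : seq int) : all (mem [:: -1; 0; 1]) l ->
  alternating l && (\sum_(x <- l) x == 1) = alt_from 0 l.
Proof.
move=> l01; have [-> _] := alt_from_path l01; rewrite /alternating.
have e : \sum_(x <- l) x = \sum_(x <- [seq x <- l | x != 0]) x.
  rewrite big_filter [RHS]big_mkcond; apply: eq_bigr => x _.
  by case: eqVneq => // ->.
have : all (mem [:: -1; 1]) [seq x <- l | x != 0].
  apply/allP => x; rewrite mem_filter => /andP[x0 /(allP l01)].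
  by rewrite !inE (negPf x0).
rewrite e; case: [seq x <- l | x != 0] => {e l01 l} [|x l] //=.
rewrite !inE => /andP[/orP[]/eqP-> l11] //=.
suff H : path (fun x y : int => x * y < 0) (-1) l -> \sum_(x <- l) x <= 1.
  rewrite big_cons; apply/negbTE/negP => /andP[/H].
  by move: (\big[_/_]_(_ <- _) _) => S le1 /eqP; lia.
suff [] : (path (fun x y : int => x * y < 0) (-1) l -> \sum_(x <- l) x <= 1) /\
  (path (fun x y : int => x * y < 0) 1 l -> \sum_(x <- l) x <= 0) by [].
elim: l l11 => [|x' l IH] /=; first by rewrite big_nil.
move=> /andP[+ /IH]; rewrite big_cons.
move: (\big[_/_]_(_ <- _) _) => S + [IH0 IH1].
rewrite !inE => /orP[]/eqP-> /=.
  by split=> // /IH0; lia.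
by split=> // /IH1; lia.
Qed.

(** * Summation over symmetric matrices, row by row *)

Definition fcons (T : Type) m (x : T) (g : {ffun 'I_m -> T}) :
    {ffun 'I_m.+1 -> T} :=
  [ffun i => if unlift ord0 i is Some j then g j else x].

Lemma sum_ffunS (T : finType) m (F : {ffun 'I_m.+1 -> T} -> int) :
  \sum_f F f = \sum_x \sum_g F (fcons x g).
Proof.
rewrite pair_big /= (reindex (fun p : T * {ffun 'I_m -> T} => fcons p.1 p.2)) //=.
exists (fun f => (f ord0, [ffun j => f (lift ord0 j)])) => [[x g]|f] _ /=.
  congr pair; first by rewrite ffunE unlift_none.
  by apply/ffunP => j; rewrite !ffunE liftK.
apply/ffunP => i; rewrite ffunE.
by case: unliftP => [j ->|->]; rewrite ?ffunE.
Qed.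

Lemma sum_sign (F : int -> int) :
  \sum_(x : sign_entry) F (val x) = F (-1) + F 0 + F 1.
Proof.
have -> : F (-1) + F 0 + F 1 = \sum_(x <- [:: -1; 0; 1]) F x.
  by rewrite !big_cons big_nil addr0 addrA.
rewrite -(big_map val predT F) /=; apply: perm_big; apply: uniq_perm => //.
  by rewrite map_inj_uniq ?index_enum_uniq //; apply: val_inj.
move=> x; apply/mapP/idP => [[y _ ->]|xs]; first exact: (valP y).
by exists (SeqSub xs); rewrite ?mem_index_enum.
Qed.

Definition vals m (r : {ffun 'I_m -> sign_entry}) : seq int :=
  [seq val (r j) | j <- enum 'I_m].

Lemma vals_cons m x (r : {ffun 'I_m -> sign_entry}) :
  vals (fcons x r) = val x :: vals r.
Proof.
rewrite /vals enum_ordSl /= ffunE unlift_none; congr cons.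
by rewrite -map_comp; apply: eq_map => j /=; rewrite ffunE liftK.
Qed.

Lemma size_vals m (r : {ffun 'I_m -> sign_entry}) : size (vals r) = m.
Proof. by rewrite size_map size_enum_ord. Qed.

Lemma vals_nil (r : {ffun 'I_0 -> sign_entry}) : vals r = [::].
Proof. by rewrite /vals; case: (enum 'I_0) (size_enum_ord 0). Qed.

Definition bit (b : bool) : int := (b : nat)%:Z.
Definition vadd (v l : seq int) := [seq p.1 + p.2 | p <- zip v l].

Notation transfer1 := (transfer (fun=> 1 : int) (fun=> 1) (fun=> 1) (fun=> 1) 1).

(** The state [h] is the sum of the entries still to come, and [alt_from] starts from the sum of
    those already read; together they make 1, hence [~~ h]. The condition on [phi] discards rows
    that push a column sum out of {0, 1}. *)
Lemma sum_alt_from m h vb (phi : seq int -> int) : size vb = m ->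
  (forall l, ~~ all is01 l -> phi l = 0) ->
  \sum_(r : {ffun 'I_m -> sign_entry}) (alt_from (bit (~~ h)) (vals r))%:R
     * phi (vadd (map bit vb) (vals r))
  = transfer1 (nseq m 1) h (phi \o map bit) vb.
Proof.
elim: m h vb phi => [|m IH] h [|b vb] phi //=.
  move=> _ _.
  rewrite (big_pred1 [ffun=> SeqSub (mem_head (-1) [:: 0; 1])]) => [|r].
    by rewrite vals_nil; case: h; rewrite /= ?mul0r ?mul1r.
  by apply/esym/eqP/ffunP => -[].
case=> svb phi0.
rewrite sum_ffunS.
pose G x := \sum_(r : {ffun 'I_m -> sign_entry})
     (alt_from (bit (~~ h)) (x :: vals r))%:R * phi (bit b + x :: vadd (map bit vb) (vals r)).
transitivity (\sum_(x : sign_entry) G (val x)).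
  by apply: eq_bigr => x _; apply: eq_bigr => r _; rewrite vals_cons.
rewrite sum_sign.
have GE x g u : bit (~~ h) + x = bit (~~ g) -> bit b + x = bit u ->
    G x = transfer1 (nseq m 1) g (fun t => phi (map bit (u :: t))) vb.
  move=> sx bx; rewrite -[RHS](IH g vb (fun t => phi (bit u :: t))) //.
    apply: eq_bigr => r _; rewrite bx /= sx.
    by have -> // : is01 (bit (~~ h)) by case: (h).
  by move=> l nl; apply: phi0; rewrite /= negb_and nl orbT.
have Gs x : ~~ is01 (bit (~~ h) + x) -> G x = 0.
  move=> ns; rewrite /G big1 // => r _ /=.
  by rewrite (contraNF (@alt_from01 _ _) ns) andbF mul0r.
have Gb x : ~~ is01 (bit b + x) -> G x = 0.
  by move=> nb; rewrite /G big1 // => r _; rewrite phi0 ?mulr0 //= negb_and nb.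
move: G GE Gs Gb => G; case: h; case: b => GE Gs Gb /=; rewrite ?mul1r.
- by rewrite (Gs (-1)) // (GE 0 true true) // (Gb 1) // add0r addr0.
- by rewrite (Gs (-1)) // (GE 0 true false) // (GE 1 false true) // add0r.
- by rewrite (Gs 1) // (GE 0 false true) // (GE (-1) true false) // addr0 addrC.
- by rewrite (Gs 1) // (GE 0 false false) // (Gb (-1)) // add0r addr0.
Qed.

Definition bordered (T : Type) m (x : T) (r : {ffun 'I_m -> T}) (B : 'M[T]_m) :
    'M[T]_m.+1 :=
  \matrix_(i, j) match unlift ord0 i, unlift ord0 j with
                 | Some i', Some j' => B i' j'
                 | Some k, None | None, Some k => r k
                 | None, None => x
                 end.

Lemma sum_bordered (T : finType) m (F : 'M[T]_m.+1 -> int) :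
  (forall B, B^T != B -> F B = 0) ->
  \sum_B F B = \sum_x \sum_r \sum_B F (bordered x r B).
Proof.
move=> F0; rewrite pair_big pair_big /=.
rewrite (bigID (fun B : 'M_m.+1 => B^T == B)) /=.
rewrite [X in _ + X]big1 ?addr0; last exact: F0.
pose f (p : T * {ffun 'I_m -> T} * 'M[T]_m) := bordered p.1.1 p.1.2 p.2.
rewrite (reindex_onto f (fun B => (B ord0 ord0, [ffun j => B ord0 (lift ord0 j)],
          \matrix_(i, j) B (lift ord0 i) (lift ord0 j)))) /=; last first.
  move=> B /eqP /matrixP symB; apply/matrixP => i j; rewrite mxE /=.
  case: unliftP => [i' ->|->]; case: unliftP => [j' ->|->]; rewrite ?mxE ?ffunE //.
  by rewrite -symB mxE.
rewrite big_mkcond; apply: eq_bigr => -[[x r] B] _ /=.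
have -> : (f (x, r, B) ord0 ord0, [ffun j => f (x, r, B) ord0 (lift ord0 j)],
     \matrix_(i, j) f (x, r, B) (lift ord0 i) (lift ord0 j)) = (x, r, B).
  congr (_, _, _); first by rewrite mxE unlift_none.
    by apply/ffunP => j; rewrite ffunE mxE unlift_none liftK.
  by apply/matrixP => i j; rewrite !mxE !liftK.
by rewrite eqxx andbT; case: ifPn => // /F0 ->.
Qed.

(* The lower right block left by peeling off the first rows and columns of a
   symmetric ASM; [v] records the column sums of the removed rows. *)
Definition dsasm_from (d : nat) (v : seq int) m (A : 'M[int]_m) :=
  [&& A^T == A, [forall i : 'I__, alt_from v`_i [seq A i j | j <- enum 'I_m]]
    & (\sum_i (A i i != 0) == d)%N].

(** By symmetry the entries of [r] also start the rows below, so one list [v] serves both as column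
    sums and as partial row sums. *)
Lemma dsasm_from_bordered d v0 v m x (r : {ffun 'I_m -> sign_entry})
    (B : 'M[sign_entry]_m) :
  size v = m -> all is01 v ->
  dsasm_from d (v0 :: v) (int_mx (bordered x r B)) =
  [&& alt_from v0 (val x :: vals r), ((val x != 0%R) <= d)%N
    & dsasm_from (d - (val x != 0%R)) (vadd v (vals r)) (int_mx B)].
Proof.
move=> sv v01; set A := int_mx _.
have A00 : A ord0 ord0 = val x by rewrite !mxE unlift_none.
have A0 j : A ord0 (lift ord0 j) = val (r j) by rewrite !mxE unlift_none liftK.
have Ai0 i : A (lift ord0 i) ord0 = val (r i) by rewrite !mxE unlift_none liftK.
have Aij i j : A (lift ord0 i) (lift ord0 j) = int_mx B i j by rewrite !mxE !liftK.
have symE : (A^T == A) = ((int_mx B)^T == int_mx B).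
  apply/eqP/eqP => /matrixP e; apply/matrixP => i j.
    by have := e (lift ord0 i) (lift ord0 j); rewrite mxE !Aij => <-; rewrite mxE.
  rewrite mxE; case: (unliftP ord0 i) => [i' ->|->];
    case: (unliftP ord0 j) => [j' ->|->]; rewrite ?A00 ?A0 ?Ai0 ?Aij //.
  by have := e i' j'; rewrite [LHS]mxE.
have row0 : [seq A ord0 j | j <- enum 'I_m.+1] = val x :: vals r.
  by rewrite enum_ordSl /= A00 -map_comp; congr cons; apply: eq_map => j /=.
have rowi i : [seq A (lift ord0 i) j | j <- enum 'I_m.+1]
    = val (r i) :: [seq int_mx B i j | j <- enum 'I_m].
  by rewrite enum_ordSl /= Ai0 -map_comp; congr cons; apply: eq_map => j /=.
have srl := size_vals r.
have vE (i : 'I_m) : (vadd v (vals r))`_i = v`_i + val (r i).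
  rewrite (nth_map (0, 0)) ?size_zip ?srl ?sv ?minnn // nth_zip ?srl //=.
  by rewrite (nth_map i) ?size_enum_ord // nth_ord_enum.
have rowsE :
    [forall i : 'I__, alt_from (v0 :: v)`_i [seq A i j | j <- enum 'I_m.+1]]
  = alt_from v0 (val x :: vals r) &&
    [forall i : 'I__, alt_from (vadd v (vals r))`_i
                               [seq int_mx B i j | j <- enum 'I_m]].
  apply/forallP/andP => [ok|[ok0 /forallP ok] i].
    split; first by rewrite -row0; apply: (ok ord0).
    by apply/forallP => i; have := ok (lift ord0 i); rewrite rowi vE /= => /andP[].
  case: (unliftP ord0 i) => [j ->|->]; last by rewrite row0.
  rewrite rowi (_ : (v0 :: v)`_(lift ord0 j) = v`_j) //= -vE ok andbT.
  by apply: (allP v01); rewrite mem_nth // sv.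
rewrite /dsasm_from symE rowsE big_ord_recl A00.
have -> : (\sum_(i < m) (A (lift ord0 i) (lift ord0 i) != 0%R) =
    \sum_(i < m) (int_mx B i i != 0%R))%N by apply: eq_bigr => i _; rewrite Aij.
set S := (\sum_(i < m) (int_mx B i i != 0%R))%N.
have -> : ((val x != 0%R) + S == d)%N
    = ((val x != 0%R) <= d)%N && (S == d - (val x != 0%R))%N by lia.
case: (_^T == _); case: (alt_from _ _); rewrite ?andbF //=.
exact: andbCA.
Qed.

Definition ndsasm d m v : int :=
  \sum_(B : 'M[sign_entry]_m) (dsasm_from d v (int_mx B))%:R.

Lemma ndsasm0 d m v : size v = m -> ~~ all is01 v -> ndsasm d m v = 0.
Proof.
move=> sv /allPn[y /(nthP 0)[i]]; rewrite sv => im <- ny.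
apply: big1 => B _; suff -> : dsasm_from d v (int_mx B) = false by [].
apply/negP => /and3P[_ /forallP/(_ (Ordinal im)) /alt_from01 + _] /=.
by rewrite (negPf ny).
Qed.

Notation one := (fun=> 1 : int).
Notation triangle1 := (triangle one one one one one one one).

Lemma sum_ndsasm d v0 v m : size v = m -> all is01 v ->
  ndsasm d m.+1 (v0 :: v) =
  \sum_(x : sign_entry) \sum_(r : {ffun 'I_m -> sign_entry})
   (alt_from v0 (val x :: vals r))%:R * (((val x != 0) <= d)%N%:R
     * ndsasm (d - (val x != 0))%N m (vadd v (vals r))).
Proof.
move=> sv v01; rewrite /ndsasm sum_bordered; last first.
  move=> B nB; suff /negPf-> : ~~ dsasm_from d (v0 :: v) (int_mx B) by [].
  apply: contra nB => /and3P[/eqP sB _ _]; apply/eqP; apply: int_mx_inj.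
  by rewrite -[RHS]sB /int_mx map_trmx.
apply: eq_bigr => x _; apply: eq_bigr => r _; rewrite mulrA mulr_sumr.
apply: eq_bigr => B _; rewrite dsasm_from_bordered // -!natrM -!mulnb.
by rewrite mulnA.
Qed.

Lemma ndsasmE (d : bool) m vb : size vb = m ->
  ndsasm d m (map bit vb) = triangle1 d (nseq m 1) vb.
Proof.
elim: m d vb => [|m IH] d [|b vb] //= => [_|[svb]].
  pose M0 : 'M[sign_entry]_0 := \matrix_(i, j) SeqSub (mem_head (-1) [:: 0; 1]).
  rewrite /ndsasm (big_pred1 M0) => [|B].
    rewrite /dsasm_from big_ord0; have -> : forall A : 'M[int]_0, A^T == A.
      by move=> A; apply/eqP/matrixP => -[].
    have -> : [forall i : 'I_0, alt_from (map bit [::])`_i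
       [seq int_mx M0 i j | j <- enum 'I_0]].
      by apply/forallP => -[].
    by case: d.
  by apply/esym/eqP/matrixP => -[].
have v01 : all is01 (map bit vb) by apply/allP => _ /mapP[c _ ->]; case: c.
rewrite sum_ndsasm ?size_map //.
pose G (x : int) := \sum_(r : {ffun 'I_m -> sign_entry})
   (alt_from (bit b) (x :: vals r))%:R * (((x != 0) <= d)%N%:R
     * ndsasm (d - (x != 0))%N m (vadd (map bit vb) (vals r))).
rewrite (sum_sign G).
have svadd (r : {ffun 'I_m -> sign_entry}) : size (vadd (map bit vb) (vals r)) = m.
  by rewrite size_map size_zip size_map svb size_vals minnn.
(* The truncation is explicit because [ndsasm0] yields vanishing only on lists of length [m]. *)
pose phi d' l := (all is01 l)%:R * ndsasm d' m l.
have phiE d' (r : {ffun 'I_m -> sign_entry}) :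
    ndsasm d' m (vadd (map bit vb) (vals r)) = phi d' (vadd (map bit vb) (vals r)).
  by rewrite /phi; case: (boolP (all _ _)) => [|/ndsasm0->]; rewrite ?mul1r ?mul0r.
have H (d' h : bool) : \sum_(r : {ffun 'I_m -> sign_entry})
    (alt_from (bit (~~ h)) (vals r))%:R * phi d' (vadd (map bit vb) (vals r))
  = transfer1 (nseq m 1) h (triangle1 d' (nseq m 1)) vb.
  rewrite sum_alt_from // => [|l /negPf nl]; last by rewrite /phi nl mul0r.
  apply: transfer_ext => t; rewrite size_nseq => st; rewrite /phi /= IH //.
  suff -> : all is01 (map bit t) by rewrite mul1r.
  by apply/allP => _ /mapP[c _ ->]; case: c.
have G0 : G 0 = transfer1 (nseq m 1) (~~ b) (triangle1 d (nseq m 1)) vb.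
  rewrite -H negbK; apply: eq_bigr => r _; rewrite phiE /= addr0 subn0 mul1r.
  by congr (_%:R * _); case: (b).
have G1 x : x != 0 -> bit b + x = bit (~~ b) -> G x =
    d%:R * transfer1 (nseq m 1) b (triangle1 false (nseq m 1)) vb.
  move=> x0 bx; rewrite -H mulr_sumr; apply: eq_bigr => r _.
  rewrite /= x0 bx phiE; case: d {IH G G0} => /=; last by rewrite !mul0r mulr0.
  by rewrite !mul1r; congr (_%:R * _); case: (b).
have G2 x : ~~ is01 (bit b + x) -> G x = 0.
  move=> nx; rewrite /G big1 // => r _ /=.
  by rewrite (contraNF (@alt_from01 _ _) nx) andbF mul0r.
rewrite mul1r G0 addrAC addrC; move: G G1 G2 {G0} => G; case: b => G1 G2 /=.
  by rewrite (G1 (-1)) // (G2 1) // addr0; case: (d); rewrite /= ?mul0r ?mul1r.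
by rewrite (G1 1) // (G2 (-1)) // add0r; case: (d); rewrite /= ?mul0r ?mul1r.
Qed.

(** For a symmetric matrix the column conditions repeat the row conditions, and either parity asks
    for exactly [odd m] nonzero diagonal entries. *)
Lemma osasm_dsasm_from m (B : 'M[sign_entry]_m) :
  is_osasm (int_mx B) = dsasm_from (odd m) (nseq m 0) (int_mx B).
Proof.
set A := int_mx B.
have A01 i j : A i j \in [:: -1; 0; 1] by rewrite mxE; apply: (valP (B i j)).
rewrite /is_osasm /is_dsasm /is_asm /dsasm_from -!andbA.
have -> : [forall i, forall j, A i j \in [:: -1; 0; 1]].
  by apply/forallP => i; apply/forallP => j; apply: A01.
have rowE (i : 'I_m) :
    alternating [seq A i j | j <- enum 'I_m] && (\sum_j A i j == 1)
    = alt_from (nseq m 0)`_i [seq A i j | j <- enum 'I_m].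
  rewrite nth_nseq if_same -alternating_alt_from ?big_map ?big_enum //.
  by apply/allP => _ /mapP[j _ ->]; apply: A01.
have diagE :
    (if odd m then #|[set i | A i i != 0]| == 1%N else [forall i, A i i == 0])
    = (\sum_i (A i i != 0%R) == odd m)%N.
  case: (odd m).
    rewrite -sum1_card big_mkcond; congr (_ == _); apply: eq_bigr => i _.
    by rewrite inE; case: (_ != _).
  by rewrite sum_nat_eq0; apply: eq_forallb => i; case: eqP.
rewrite diagE /=; case: eqVneq => [/matrixP sA|_]; last by rewrite !andbF.
have colE :
     [forall j, alternating [seq A i j | i <- enum 'I_m] && (\sum_i A i j == 1)]
   = [forall i, alternating [seq A i j | j <- enum 'I_m] && (\sum_j A i j == 1)].
  have sA' i j : A j i = A i j by have := sA i j; rewrite [LHS]mxE.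
  apply: eq_forallb => i; congr andb.
    by congr alternating; apply: eq_map => j.
  by congr (_ == _); apply: eq_bigr => j _.
rewrite colE andbA andbb /=; congr andb; exact: eq_forallb.
Qed.

Lemma map_bit0 m : map bit (nseq m false) = nseq m 0.
Proof. by rewrite map_nseq. Qed.

Lemma card_OSASM m :
  #|OSASM m|%:Z = triangle1 (odd m) (nseq m 1) (nseq m false).
Proof.
rewrite -ndsasmE ?size_nseq // map_bit0 /ndsasm -sum1_card -natz natr_sum.
rewrite big_mkcond.
by apply: eq_bigr => B _; rewrite inE osasm_dsasm_from; case: ifP.
Qed.

(** * The sign along the first row *)

Lemma vadd0 m l : size l = m -> vadd (nseq m 0) l = l.
Proof.
elim: m l => [|m IH] [|x l] //= [/IH e].
by rewrite /vadd /= add0r -/(vadd _ _) e.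
Qed.

Notation signed_transfer :=
  (transfer (fun=> 1 : int) (fun=> -1) (fun=> 1) (fun=> 1) 1).

(** Below columns in state 0 a surviving row has no -1, hence a single 1. Each zero before it is a
    [wb] vertex and supplies a sign; each zero after it is a [wa] vertex. *)
Lemma sum_alt_from_sign m (phi : seq int -> int) :
  (forall l, ~~ all is01 l -> phi l = 0) ->
  \sum_(r : {ffun 'I_m -> sign_entry}) (alt_from 0 (vals r))%:R
     * ((-1) ^+ index 1 (vals r) * phi (vals r))
  = signed_transfer (nseq m 1) true (phi \o map bit) (nseq m false).
Proof.
elim: m phi => [|m IH] phi phi0.
  by apply: big1 => r _; rewrite vals_nil mul0r.
rewrite sum_ffunS.
pose G (x : int) := \sum_(r : {ffun 'I_m -> sign_entry})
     (alt_from 0 (x :: vals r))%:R * ((-1) ^+ index 1 (x :: vals r) * phi (x :: vals r)).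
transitivity (\sum_(x : sign_entry) G (val x)).
  by apply: eq_bigr => x _; apply: eq_bigr => r _; rewrite vals_cons.
rewrite sum_sign.
have -> : G (-1) = 0 by apply: big1 => r _; rewrite phi0 ?mulr0.
have phi0' x l : ~~ all is01 l -> phi (x :: l) = 0.
  by move=> nl; apply: phi0; rewrite /= negb_and nl orbT.
have -> : G 0 = -1 * signed_transfer (nseq m 1) true
    (fun t => phi (map bit (false :: t))) (nseq m false).
  rewrite -[signed_transfer _ _ _ _](IH (fun l => phi (0 :: l))) => [|l /phi0'//].
  rewrite mulr_sumr; apply: eq_bigr => r _.
  by rewrite /= addr0 exprS; ring.
have -> : G 1 = signed_transfer (nseq m 1) false
    (fun t => phi (map bit (true :: t))) (nseq m false).
  have := @sum_alt_from m false (nseq m false) (fun l => phi (1 :: l))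
            (size_nseq _ _).
  have E wb f : transfer one wb one one 1 (nseq m 1) false f (nseq m false)
              = f (nseq m false).
    have := transfer_false0 one wb one one 1 (nseq m 1) f.
    by rewrite size_nseq big1 ?mul1r.
  rewrite !E => H; transitivity (phi (1 :: map bit (nseq m false))) => //.
  rewrite -[RHS]H => [|l /phi0' //]; apply: eq_bigr => r _.
  by rewrite map_bit0 vadd0 ?size_vals //= expr0 mul1r.
by rewrite add0r /= mul1r.
Qed.

Lemma alt_from_index (l : seq int) k : alt_from 0 l -> all is01 l ->
  l`_k = 1 -> k = index 1 l.
Proof.
elim: l k => [|x l IH] [|k] //= ok /andP[x01 l01]; first by move->.
move: x01 ok => /orP[]/eqP->; rewrite add0r ?eqxx //=.
  by move=> ok /(IH _ ok l01) ->.
move=> ok lk; suff : all (pred1 0) l.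
  move=> /allP l0; case: (ltnP k (size l)) => kl.
    by have := l0 _ (mem_nth 0 kl); rewrite lk.
  by rewrite nth_default in lk.
elim: l ok l01 {IH lk} => //= x' l IH ok /andP[+ l01].
move: ok => /[swap] /orP[]/eqP->.
  by rewrite addr0 => ok; rewrite IH.
by move/alt_from01.
Qed.

Lemma alt_from_mem1 (l : seq int) : alt_from 0 l -> all is01 l -> 1 \in l.
Proof.
elim: l => //= x l IH ok /andP[x01 l01]; move: x01 ok => /orP[]/eqP->.
  by rewrite add0r inE => ok; rewrite (IH ok) ?orbT.
by rewrite inE eqxx.
Qed.

(** One successor accounts for the corner entry in front of [r], the other for numbering columns
    from 1. *)
Lemma T_stat_bordered m x (r : {ffun 'I_m -> sign_entry}) (B : 'M[sign_entry]_m) :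
  val x = 0 -> alt_from 0 (vals r) -> all is01 (vals r) ->
  T_stat (int_mx (bordered x r B)) = (index 1 (vals r)).+2.
Proof.
move=> x0 ok r01; rewrite /T_stat.
have A0 j : int_mx (bordered x r B) ord0 (lift ord0 j) = (vals r)`_j.
  by rewrite !mxE unlift_none liftK (nth_map j) ?size_enum_ord // nth_ord_enum.
case: pickP => [[i j] /= /andP[/eqP i0]|].
  have -> : i = ord0 by apply: val_inj.
  case: (unliftP ord0 j) => [k ->|->]; last by rewrite !mxE unlift_none x0.
  by rewrite A0 => /eqP/(alt_from_index ok r01) <-.
have im : (index 1%R (vals r) < m)%N.
  by rewrite -[m in (_ < m)%N](size_vals r) index_mem alt_from_mem1.
move=> /(_ (ord0, lift ord0 (Ordinal im))) /=.
by rewrite A0 nth_index ?eqxx // alt_from_mem1.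
Qed.

Lemma XO_signed_transfer m : ~~ odd m.+1 -> XO m.+1 (1 : int) (-1) =
  signed_transfer (nseq m 1) true (triangle1 false (nseq m 1)) (nseq m false).
Proof.
move=> em; pose phi l := (all is01 l)%:R * ndsasm false m l.
have -> :
   signed_transfer (nseq m 1) true (triangle1 false (nseq m 1)) (nseq m false) =
   signed_transfer (nseq m 1) true (phi \o map bit) (nseq m false).
  apply: transfer_ext => t; rewrite size_nseq => st /=; rewrite /phi (ndsasmE false) //.
  suff -> : all is01 (map bit t) by rewrite mul1r.
  by apply/allP => _ /mapP[c _ ->]; case: c.
rewrite -sum_alt_from_sign => [|l /negPf nl]; last by rewrite /phi nl mul0r.
rewrite /XO big_mkcond.
transitivity (\sum_(B : 'M[sign_entry]_m.+1)
   (dsasm_from 0 (0 :: nseq m 0) (int_mx B))%:R * (-1) ^+ T_stat (int_mx B) : int).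
  apply: eq_bigr => B _; rewrite inE osasm_dsasm_from (negPf em) /= expr1n mul1r.
  by case: ifP => _; rewrite ?mul1r ?mul0r.
rewrite sum_bordered; last first.
  move=> B nB.
  suff /negPf-> : ~~ dsasm_from 0 (0 :: nseq m 0) (int_mx B) by rewrite mul0r.
  apply: contra nB => /and3P[/eqP sB _ _]; apply/eqP; apply: int_mx_inj.
  by rewrite -[RHS]sB /int_mx map_trmx.
pose G (x : int) := \sum_(r : {ffun 'I_m -> sign_entry})
  (x == 0)%:R * (alt_from 0 (vals r))%:R
  * ((-1) ^+ index 1 (vals r) * phi (vals r)).
transitivity (\sum_(x : sign_entry) G (val x)); last first.
  rewrite sum_sign /G [X in X + _ + _]big1 ?[X in _ + X]big1 ?add0r ?addr0;
    try by move=> *; rewrite !mul0r.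
  by apply: eq_bigr => r _; rewrite mul1r.
apply: eq_bigr => x _; apply: eq_bigr => r _.
case: (eqVneq (val x) 0) => [x0|x0]; last first.
  rewrite !mul0r big1 // => B _; rewrite dsasm_from_bordered ?size_nseq //.
    by rewrite x0 /= andbF mul0r.
  by apply/allP => _ /nseqP[-> _].
rewrite mul1r /phi /ndsasm !mulr_sumr; apply: eq_bigr => B _.
rewrite dsasm_from_bordered ?size_nseq //; last by apply/allP => _ /nseqP[-> _].
rewrite vadd0 ?size_vals // x0 eqxx /= add0r subn0.
case: (boolP (alt_from 0 _)) => ok; rewrite ?mul0r //.
case: (boolP (all is01 _)) => r01; last first.
  have -> : dsasm_from 0 (vals r) (int_mx B) = false;
    last by rewrite !(mul0r, mulr0).
  apply/negP => /and3P[_ /forallP okB _]; case/negP: r01.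
  apply/(all_nthP 0) => i; rewrite size_vals => im.
  exact: alt_from01 (okB (Ordinal im)).
rewrite T_stat_bordered // !mul1r /= mulrC; congr (_ * _).
by rewrite !exprS; ring.
Qed.

(** * Specialization at x_i = 1 *)

Section Homogeneous.
Variable (R : comNzRingType).
Notation one := (fun=> 1 : R).
Notation triangle_one := (triangle one one one one one one one).

Lemma prod_nseq m (f : R -> R) : \prod_(x <- nseq m 1) f x = f 1 ^+ m.
Proof. by elim: m => [|m IH]; rewrite ?big_nil // big_cons IH exprS. Qed.

Section Scale.
Variables (wa wb wc1 wc2 wk wD1 wD2 : R -> R) (c k : R).
Hypotheses (a1 : wa 1 = c) (b1 : wb 1 = c) (c11 : wc1 1 = c) (c21 : wc2 1 = c).
Hypotheses (k1 : wk 1 = k) (D11 : wD1 1 = 1) (D21 : wD2 1 = 1).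

Lemma transfer_scale m h phi v : transfer wa wb wc1 wc2 1 (nseq m 1) h phi v =
  c ^+ m * transfer one one one one 1 (nseq m 1) h phi v.
Proof.
elim: m h phi v => [|m IH] h phi [|b v] //=; rewrite ?mulr0 ?expr0 ?mul1r //.
rewrite a1 b1 c11 c21 !IH exprS.
by case: ifP => _; [|case: ifP => _]; ring.
Qed.

(** There are ['C(m, 2)] crossings of weight [c] and [m] turns of weight [k], one of them replaced
    by weight 1 if [d] holds; [k ^+ d] on the left avoids a division. *)
Lemma triangle_scale (d : bool) m v :
  k ^+ d * triangle wa wb wc1 wc2 wk wD1 wD2 d (nseq m 1) v =
  k ^+ m * c ^+ 'C(m, 2) * triangle_one d (nseq m 1) v.
Proof.
elim: m d v => [|m IH] d [|b v] /=; rewrite ?mulr0 //.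
  by case: d; rewrite /= ?mulr0 // !mulr1.
rewrite !transfer_scale k1 D11 D21 !if_same.
have H h (d' : bool) : k ^+ d' * transfer one one one one 1 (nseq m 1) h
    (triangle wa wb wc1 wc2 wk wD1 wD2 d' (nseq m 1)) v =
  k ^+ m * c ^+ 'C(m, 2)
  * transfer one one one one 1 (nseq m 1) h (triangle_one d' (nseq m 1)) v.
  by rewrite -!transferZ; apply: transfer_ext => t _; apply: IH.
rewrite binS bin1 exprD exprS.
case: d => /=; last first.
  rewrite !addr0 mul1r -[transfer _ _ _ _ _ _ _ _ _ in LHS]mul1r.
  by have /= := H (~~ b) false; rewrite expr0 => ->; ring.
move: (H (~~ b) true) (H b false); rewrite expr1 expr0 mul1r !mul1r => H1 H0.
set A1 := transfer _ _ _ _ _ _ _ (triangle _ _ _ _ _ _ _ true _) v in H1 *.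
transitivity (k * c ^+ m * (k * A1 + transfer one one one one 1 (nseq m 1) b
    (triangle wa wb wc1 wc2 wk wD1 wD2 false (nseq m 1)) v)); first by ring.
by rewrite H1 H0; ring.
Qed.
End Scale.

Lemma transfer_false_nseq wa wb wc1 wc2 x m phi :
  transfer wa wb wc1 wc2 x (nseq m 1) false phi (nseq m false) =
  wa x ^+ m * phi (nseq m false) :> R.
Proof.
have := transfer_false0 wa wb wc1 wc2 x (nseq m 1) phi.
by rewrite size_nseq (prod_nseq m (fun y => wa (x * y))) mulr1.
Qed.

(** One vertex has weight [c] and the other m - 1 have weight [a] or [- a]; the factor [a] on the
    left restores the exponent [m]. *)
Lemma transfer_sign_scale (wa wb wc1 wc2 : R -> R) x a c m phi :
  wa x = a -> wb x = - a -> wc1 x = c ->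
  a * transfer wa wb wc1 wc2 x (nseq m 1) true phi (nseq m false) =
  a ^+ m * c * transfer one (fun=> -1) one one 1 (nseq m 1) true phi (nseq m false).
Proof.
move=> ea eb ec; elim: m phi => [|m IH] phi /=; first by rewrite !mulr0.
rewrite !mulr1 eb ec !transfer_false_nseq ea expr1n exprS.
transitivity (- a * (a * transfer wa wb wc1 wc2 x (nseq m 1) true
     (fun t => phi (false :: t)) (nseq m false))
   + a * c * (a ^+ m * phi (true :: nseq m false))).
  by ring.
by rewrite IH; ring.
Qed.
End Homogeneous.

(** * Evaluation at a cube root of unity and conclusion *)

Lemma cube_root_exists (F : numClosedFieldType) : {rho : F | rho * rho = - rho - 1}.
Proof.
exists ((-1 + sqrtC (-3%:R)) / 2%:R).
have := sqrtCK (-3%:R : F); move: (sqrtC _) => s s2.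
have s2' : s * s = - 3%:R by rewrite -s2 expr2.
by field: s2'.
Qed.

Theorem theorem4p3 (n : nat) :
  #|OSASM (2 * n + 1)|%:Z = 2 ^+ (2 * n) * XO (2 * n + 2) (1 : int) (-1).
Proof.
set m := (2 * n + 1)%N; rewrite (_ : 2 * n + 2 = m.+1)%N; last by rewrite /m; lia.
have mE : m = n.*2.+1 by rewrite /m; lia.
have om : odd m by rewrite mE /= odd_double.
rewrite card_OSASM XO_signed_transfer /= om //.
set N := triangle _ _ _ _ _ _ _ _ _ _; set S := transfer _ _ _ _ _ _ _ _ _.
have [rho rho2] := cube_root_exists algC.
pose triangle_one d v := triangle (fun=> 1 : algC) (fun=> 1) (fun=> 1) (fun=> 1)
   (fun=> 1) (fun=> 1) (fun=> 1) d (nseq m 1) v.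
pose f : {rmorphism int -> algC} := intr.
have f1 (y : int) : f 1 = 1 by rewrite rmorph1.
have fN1 (y : int) : f (-1) = -1 by rewrite rmorphN1.
have map1 : map f (nseq m 1) = nseq m 1 by rewrite map_nseq rmorph1.
have triangleE d v : f (triangle1 d (nseq m 1) v) = triangle_one d v.
  pose o : int -> int := fun=> 1; pose o' : algC -> algC := fun=> 1.
  have := @rmorph_triangle _ _ f o o o o o o o o' o' o' o' o' o' o'
            f1 f1 f1 f1 f1 f1 f1 d (nseq m 1) v.
  by rewrite map1.
have SE : f S = transfer (fun=> 1) (fun=> -1) (fun=> 1) (fun=> 1) 1 (nseq m 1) true
     (triangle_one false) (nseq m false).
  have := @rmorph_transfer _ _ f (fun=> 1) (fun=> -1) (fun=> 1) (fun=> 1)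
    (fun=> 1) (fun=> -1) (fun=> 1) (fun=> 1) f1 fN1 f1 f1 1 (nseq m 1) true
    (triangle1 false (nseq m 1)) (nseq m false).
  rewrite map1 rmorph1 => ->.
  by apply: transfer_ext => t _; apply: triangleE.
apply: (@intr_inj algC); change (f N = f (2 ^+ (2 * n) * S)).
rewrite rmorphM rmorphXn rmorph_nat.
have := mismatch'1 n rho2; rewrite -mE /mismatch' !prod_nseq !mulr1.
set c := rho - 1.
have YE sw : (1 + rho) * pfunY rho sw (nseq m 1)
           = (1 + rho) ^+ m * c ^+ 'C(m, 2) * f N.
  rewrite triangleE /triangle_one.
  rewrite -(triangle_scale (wa := wt_a rho sw) (wb := wt_b rho sw)
    (wc1 := wt_c1 rho) (wc2 := wt_c2 rho) (wk := wt_k rho sw)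
    (wD1 := fun=> 1) (wD2 := id)) /pfunY /pfun ?size_nseq //;
    by rewrite /wt_a /wt_b /wt_c2 /wt_k /c; case: sw; ring.
(* On the extra line all products are -1, where [wt_a] is [rho * rho] and [wt_b] is its opposite;
   this produces the signs in [S]. *)
have ZE : rho * rho * pfunZ rho (-1 :: nseq m 1)
        = (rho * rho) ^+ m * c * (c ^+ 'C(m, 2) * f S).
  rewrite /pfunZ /pfun /= size_nseq addr0 mul1r.
  rewrite (@transfer_sign_scale _ _ _ _ _ _ (rho * rho) c) //; last 2 first.
  - by rewrite /wt_a; ring: rho2.
  - by rewrite /wt_b; ring: rho2.
  rewrite SE -[c ^+ 'C(m, 2) * _]transferZ; congr (_ * _).
  apply: transfer_ext => t _.
  rewrite -[LHS]mul1r; transitivity (1 ^+ m * c ^+ 'C(m, 2) * triangle_one false t).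
    by apply: (triangle_scale (c := c) (k := 1) _ _ _ _ _ _ _ false) => //;
      rewrite /wt_a /wt_b /wt_c2 /c; ring.
  by rewrite expr1n mul1r.
have cE : c * c = - 3%:R * rho by rewrite /c; ring: rho2.
have rho0 : rho != 0.
  apply: contra_eq_neq rho2 => ->.
  by rewrite mulr0 oppr0 add0r eq_sym oppr_eq0 oner_neq0.
have c0 : c != 0.
  apply: contra_eq_neq cE => ->.
  by rewrite mul0r eq_sym mulf_neq0 // oppr_eq0 pnatr_eq0.
have u : 1 + rho = - (rho * rho) by ring: rho2.
have rho3 : rho * rho * rho = 1 by ring: rho2.
(* Multiplying by [1 + rho], which is [- (rho * rho)], makes both [YE] and [ZE] applicable. *)
move=> /(congr1 ( *%R (1 + rho))); rewrite mulr0.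
set X := c ^+ 'C(m, 2) in YE ZE.
have X0 : X != 0 by rewrite expf_neq0.
have e1 : ((1 + rho) ^+ m) * ((1 + rho) ^+ m) = rho ^+ m.
  by rewrite -exprMn u; congr (_ ^+ _); ring: rho2.
(* The surplus exponent n + 2 + m is a multiple of 3 and drops out. *)
have e2 : rho ^+ n.+2 * (rho * rho) ^+ m = rho ^+ m.
  rewrite exprMn mulrCA -exprD (_ : n.+2 + m = 3 * n.+1)%N; last by rewrite mE; lia.
  by rewrite exprM (_ : rho ^+ 3 = 1) ?expr1n ?mulr1 // !exprS expr0 mulr1 mulrA.
(* One factor 2 of the product of the 1 + x_i cancels against the two equal terms from [pfunY]. *)
have e3 : (1 + 1) ^+ m = 2 * 2 ^+ (2 * n) :> algC.
  by rewrite -exprS; congr (_ ^+ _); rewrite /m; lia.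
rewrite e3 => H.
have : 2 * c * X * rho ^+ m * f N
     = 2 * c * X * rho ^+ m * (2 ^+ (2 * n) * f S).
  transitivity (c * ((1 + rho) * pfunY rho false (nseq m 1)
                     + (1 + rho) * pfunY rho true (nseq m 1)) * (1 + rho) ^+ m).
    by rewrite !YE -e1; ring.
  transitivity (rho ^+ n.+2 * (rho * rho * pfunZ rho (-1 :: nseq m 1))
                * (2 * 2 ^+ (2 * n))).
    apply/eqP; rewrite -subr_eq0 -H; apply/eqP.
    by move: (rho ^+ n.+2) ((1 + rho) ^+ m) (2 ^+ (2 * n)) => A B C; ring: rho2.
  by rewrite ZE -e2; ring.
by apply: mulfI; rewrite !mulf_neq0 ?expf_neq0 // pnatr_eq0.
Qed.
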